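(* For $\rho_1, \rho_2 \in (0,1]$, the rings $\mathcal{R}(\rho_1)$ and $\mathcal{R}(\rho_2)$ are isomorphic (as abstract rings) if and only if $\rho_1 = \rho_2$.
   Context: For $\rho \in (0,1]$, $B(0,\rho) = \{z \in \mathbb{C} : |z| < \rho\}$ is the open disk, and $\mathcal{R}(\rho) = \mathbb{Z}[[z]] \cap \mathcal{O}(B(0,\rho))$ denotes the ring of power series $\sum_{n\ge 0} a_n z^n$ with all $a_n \in \mathbb{Z}$ that converge on $B(0,\rho)$, with the usual addition and multiplication of power series. Isomorphisms are isomorphisms of abstract rings; no topology or continuity is assumed. *)

(* Defs.v *)
From HB Require Import structures.
From mathcomp Require Import all_boot all_order all_algebra.
From mathcomp Require Import all_classical all_reals all_analysis.
From mathcomp Require Import complex.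
From mathcomp Require Import ring lra.

Set Implicit Arguments.
Unset Strict Implicit.
Unset Printing Implicit Defensive.

Import Order.TTheory GRing.Theory Num.Theory.
Import numFieldNormedType.Exports.

Local Open Scope classical_set_scope.
Local Open Scope ring_scope.
Local Open Scope complex_scope.

Record fps (A : Type) := FPS { fps_coef : nat -> A }.

HB.instance Definition _ (A : Type) := [isNew for @fps_coef A].
HB.instance Definition _ (A : choiceType) := [Choice of fps A by <:].

Section FpsRing.
Variable A : comNzRingType.
Implicit Types f g h : fps A.

Lemma fpsP f g : fps_coef f =1 fps_coef g -> f = g.
Proof. by case: f g => [f] [g] /= /funext ->. Qed.

Definition fps_zero : fps A := FPS (fun=> 0).
Definition fps_opp f : fps A := FPS (fun n => - fps_coef f n).
Definition fps_add f g : fps A := FPS (fun n => fps_coef f n + fps_coef g n).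
Definition fps_one : fps A := FPS (fun n => (n == 0%N)%:R).
Definition fps_mul f g : fps A :=
  FPS (fun n => \sum_(k < n.+1) fps_coef f k * fps_coef g (n - k)).

Fact fps_addA : associative fps_add.
Proof. by move=> f g h; apply: fpsP => n /=; rewrite addrA. Qed.
Fact fps_addC : commutative fps_add.
Proof. by move=> f g; apply: fpsP => n /=; rewrite addrC. Qed.
Fact fps_add0 : left_id fps_zero fps_add.
Proof. by move=> f; apply: fpsP => n /=; rewrite add0r. Qed.
Fact fps_addN : left_inverse fps_zero fps_opp fps_add.
Proof. by move=> f; apply: fpsP => n /=; rewrite addNr. Qed.

HB.instance Definition _ := GRing.isZmodule.Build (fps A)
  fps_addA fps_addC fps_add0 fps_addN.

Fact fps_mul_rev f g n : fps_coef (fps_mul f g) n =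
  \sum_(k < n.+1) fps_coef f (n - k) * fps_coef g k.
Proof.
rewrite /= (reindex_inj rev_ord_inj) /=.
by apply: eq_bigr => j _; rewrite subSS subKn // -ltnS.
Qed.

Fact fps_mulA : associative fps_mul.
Proof.
move=> p q r; apply: fpsP => i; rewrite [RHS]fps_mul_rev [LHS]/=.
pose coef3 j k := fps_coef p j * (fps_coef q (i - j - k) * fps_coef r k).
transitivity (\sum_(j < i.+1) \sum_(k < i.+1 | (k <= i - j)%N) coef3 j k).
  apply: eq_bigr => /= j _; rewrite [X in _ * X]fps_mul_rev big_distrr /=.
  by rewrite (big_ord_narrow_leq (leq_subr _ _)).
rewrite (exchange_big_dep predT) //=; apply: eq_bigr => k _.
transitivity (\sum_(j < i.+1 | (j <= i - k)%N) coef3 j k).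
  apply: eq_bigl => j; rewrite -ltnS -(ltnS j) -!subSn ?leq_ord //.
  by rewrite -subn_gt0 -(subn_gt0 j) -!subnDA addnC.
rewrite (big_ord_narrow_leq (leq_subr _ _)) big_distrl /=.
by apply: eq_bigr => j _; rewrite /coef3 -!subnDA addnC mulrA.
Qed.

Fact fps_mulC : commutative fps_mul.
Proof.
move=> f g; apply: fpsP => n; rewrite fps_mul_rev /=.
by apply: eq_bigr => k _; rewrite mulrC.
Qed.

Fact fps_mul1 : left_id fps_one fps_mul.
Proof.
move=> f; apply: fpsP => n /=.
rewrite big_ord_recl subn0 /= mul1r big1 ?addr0 // => k _.
by rewrite mul0r.
Qed.

Fact fps_mulDl : left_distributive fps_mul +%R.
Proof.
move=> f g h; apply: fpsP => n /=.
by rewrite -big_split; apply: eq_bigr => k _; rewrite mulrDl.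
Qed.

Fact fps_oner_neq0 : fps_one != 0.
Proof.
by apply/eqP => /(congr1 (fun f => fps_coef f 0%N)) /eqP; rewrite /= oner_eq0.
Qed.

HB.instance Definition _ := GRing.Zmodule_isComNzRing.Build (fps A)
  fps_mulA fps_mulC fps_mul1 fps_mulDl fps_oner_neq0.

Lemma fps_coef0 n : fps_coef (0 : fps A) n = 0. Proof. by []. Qed.
Lemma fps_coefN f n : fps_coef (- f) n = - fps_coef f n. Proof. by []. Qed.
Lemma fps_coefD f g n : fps_coef (f + g) n = fps_coef f n + fps_coef g n.
Proof. by []. Qed.
Lemma fps_coef1 n : fps_coef (1 : fps A) n = (n == 0%N)%:R. Proof. by []. Qed.
Lemma fps_coefM f g n : fps_coef (f * g) n =
  \sum_(k < n.+1) fps_coef f k * fps_coef g (n - k).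
Proof. by []. Qed.

End FpsRing.

Section ConvergesOnDisk.
Variable R : realType.
Implicit Types (f g : fps int) (rho t M : R).

(* Convergence in the topology that the modulus induces on R[i]; the coercion
   to numFieldType selects that topology. *)
Definition converges_on_disk rho f : Prop :=
  forall z : R[i], `|z| < rho%:C ->
    cvgn (series (fun n => (fps_coef f n)%:~R * z ^+ n : (R[i] : numFieldType))).

Lemma norm_realC (x : R) : `|x%:C| = `|x|%:C :> R[i].
Proof. by rewrite normc_def /= expr0n addr0 sqrtr_sqr. Qed.

Lemma realC_continuous :
  continuous (fun x : R => x%:C : (R[i] : numFieldType)).
Proof.
move=> x; apply/cvgrPdist_lt => e e0.
have [e'0 eE] : 0 < complex.Re e /\ e = (complex.Re e)%:C.
  by case: e e0 => a b; rewrite ltcE /= => /andP[/eqP -> a0].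
apply: filterS (nbhsx_ballx x _ e'0) => y.
by rewrite /ball /= eE -rmorphB norm_realC ltcR.
Qed.

Lemma cvg_complex (u : (R[i] : numFieldType) ^nat) :
  cvgn (fun n => complex.Re (u n)) -> cvgn (fun n => complex.Im (u n)) -> cvgn u.
Proof.
move=> cr ci.
have -> : u = (fun n => (complex.Re (u n))%:C + 'i%C * (complex.Im (u n))%:C).
  by apply/funext => n; rewrite {1}(complexE (u n)).
have cC (v : R ^nat) : cvgn v ->
    cvgn (fun n => (v n)%:C : (R[i] : numFieldType)).
  move=> cv; apply/cvg_ex; exists (limn v)%:C.
  by apply: (continuous_cvg _ _ cv); exact: realC_continuous.
by apply: is_cvgD; [exact: cC|apply: is_cvgMr; exact: cC].
Qed.

Definition coef_bounded f t :=
  exists M, forall n, `|(fps_coef f n)%:~R| * t ^+ n <= M.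

Lemma converges_bounded rho f t :
  converges_on_disk rho f -> 0 < t < rho -> coef_bounded f t.
Proof.
move=> cf /andP[t0 tr].
have := cf t%:C; rewrite norm_realC gtr0_norm // ltcR tr => /(_ isT).
move=> /cvg_series_cvg_0 /cvgr0_norm_lt /(_ 1 ltr01) [N _ HN].
pose u n : R := `|(fps_coef f n)%:~R| * t ^+ n.
have u0 n : 0 <= u n by rewrite mulr_ge0 // exprn_ge0 // ltW.
exists (1 + \sum_(i < N) u i) => n; rewrite -/(u n).
have [nN|Nn] := ltnP n N.
  rewrite (bigD1 (Ordinal nN)) //= addrCA lerDl addr_ge0 // sumr_ge0 //.
apply: (@le_trans _ _ 1); last by rewrite lerDl sumr_ge0.
have := HN n Nn; rewrite /= normrM normrX norm_realC (gtr0_norm t0).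
rewrite -(rmorph_int (real_complex R)) norm_realC -rmorphXn -rmorphM.
by rewrite -(rmorph1 (real_complex R)) ltcR => /ltW.
Qed.

Lemma bounded_converges rho f :
  (forall t, 0 < t < rho -> coef_bounded f t) -> converges_on_disk rho f.
Proof.
move=> bf z zr.
have [r [zE r0]] : exists r, `|z| = r%:C /\ 0 <= r.
  exists (ComplexField.Normc.normc z); split => //.
  by case: z {zr} => a b; exact: sqrtr_ge0.
move: zr; rewrite zE ltcR => rr.
have [t /andP[rt tr]] : exists t, r < t < rho.
  by exists ((r + rho) / 2); rewrite !midf_lt.
have t0 : 0 < t by exact: le_lt_trans rt.
have [M HM] := bf t (introT andP (conj t0 tr)).
have M0 : 0 <= M.
  by apply: le_trans (HM 0%N); rewrite mulr_ge0 // exprn_ge0 // ltW.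
pose u n : R[i] := (fps_coef f n)%:~R * z ^+ n.
have uM n : `|u n| <= (M * (r / t) ^+ n)%:C.
  rewrite normrM normrX zE -(rmorph_int (real_complex R)) norm_realC.
  rewrite -rmorphXn -rmorphM lecR exprMn exprVn.
  by rewrite mulrCA mulrC ler_wpM2l ?exprn_ge0 // ler_pdivlMr ?exprn_gt0.
have cg : cvgn (series (geometric M (r / t))).
  apply: is_cvg_geometric_series.
  by rewrite ger0_norm ?divr_ge0 ?(ltW t0) // ltr_pdivrMr // mul1r.
have key (p : R[i] -> R) : {morph p : x y / x + y} -> p 0 = 0 ->
    (forall x, `|p x|%:C <= `|x|) ->
    cvgn (fun n => p (series u n)).
  move=> pD p0 pn.
  have -> : (fun n => p (series u n)) = series (fun n => p (u n)).
    by apply/funext => n; rewrite /series /= (big_morph _ pD p0).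
  apply: normed_cvg.
  have v0 n : 0 <= geometric M (r / t) n.
    by rewrite /geometric /= mulr_ge0 // exprn_ge0 // divr_ge0 // ltW.
  apply: (series_le_cvg _ v0 _ cg) => n /=; first exact: normr_ge0.
  by rewrite -lecR; apply: le_trans (uM n); exact: pn.
apply: cvg_complex.
  apply: key => // [[a b] [c d] //|x].
  by rewrite normc_def lecR -sqrtr_sqr ler_wsqrtr // lerDl sqr_ge0.
apply: key => // [[a b] [c d] //|x].
by rewrite normc_def lecR -sqrtr_sqr ler_wsqrtr // lerDr sqr_ge0.
Qed.

Lemma coef_boundedN f t : coef_bounded f t -> coef_bounded (- f) t.
Proof. by case=> M HM; exists M => n; rewrite fps_coefN mulrNz normrN. Qed.

Lemma coef_boundedD f g t :
  0 < t -> coef_bounded f t -> coef_bounded g t -> coef_bounded (f + g) t.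
Proof.
move=> t0 [M HM] [N HN]; exists (M + N) => n; rewrite fps_coefD intrD.
apply: le_trans (lerD (HM n) (HN n)); rewrite -mulrDl.
by rewrite ler_wpM2r ?ler_normD // exprn_ge0 // ltW.
Qed.

Lemma coef_bounded1 t : coef_bounded 1 t.
Proof.
exists 1 => -[|n]; first by rewrite fps_coef1 normr1 expr0 mulr1.
by rewrite fps_coef1 normr0 mul0r.
Qed.

Lemma coef_boundedM f g s t : 0 < s < t ->
  coef_bounded f t -> coef_bounded g t -> coef_bounded (f * g) s.
Proof.
move=> /andP[s0 st] [M HM] [N HN].
have t0 : 0 < t by exact: lt_trans st.
have M0 : 0 <= M.
  by apply: le_trans (HM 0%N); rewrite mulr_ge0 // exprn_ge0 // ltW.
have N0 : 0 <= N.
  by apply: le_trans (HN 0%N); rewrite mulr_ge0 // exprn_ge0 // ltW.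
pose h := t / s - 1.
have h0 : 0 < h by rewrite subr_gt0 ltr_pdivlMr // mul1r.
have tE : t = s * (1 + h) by rewrite /h addrC subrK mulrC divfK // gt_eqF.
have bern n : 1 + n%:R * h <= (1 + h) ^+ n.
  elim: n => [|n IH]; first by rewrite mul0r addr0.
  rewrite exprSr; apply: le_trans (ler_wpM2r _ IH); last by lra.
  have : 0 <= n%:R * h * h by rewrite !mulr_ge0 // ltW.
  by rewrite -natr1; nra.
have bnd n : `|(fps_coef (f * g) n)%:~R| * t ^+ n <= n.+1%:R * (M * N).
  rewrite fps_coefM rmorph_sum.
  apply: (@le_trans _ _ (\sum_(k < n.+1) (M * N))); last first.
    by rewrite sumr_const card_ord mulr_natl.
  apply: le_trans (ler_wpM2r (exprn_ge0 _ (ltW t0)) (ler_norm_sum _ _ _)) _.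
  rewrite mulr_suml; apply: ler_sum => k _.
  have kn : (k <= n)%N by rewrite -ltnS.
  rewrite rmorphM normrM -[in t ^+ n](subnKC kn) exprD mulrACA.
  apply: ler_pM (HM _) (HN _).
    by rewrite mulr_ge0 // exprn_ge0 // ltW.
  by rewrite mulr_ge0 // exprn_ge0 // ltW.
exists ((1 + h^-1) * (M * N)) => n.
have p0 : 0 < (1 + h) ^+ n by rewrite exprn_gt0 // addr_gt0.
rewrite -(ler_pM2r p0) -mulrA -exprMn -tE (le_trans (bnd n)) //.
rewrite mulrAC ler_wpM2r ?mulr_ge0 //.
have hV : h^-1 * h = 1 by rewrite mulVf // gt_eqF.
have hV0 : 0 < h^-1 by rewrite invr_gt0.
apply: le_trans (ler_wpM2l _ (bern n)); last by rewrite addr_ge0 // ltW.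
have -> : (1 + h^-1) * (1 + n%:R * h) =
    1 + n%:R * h + h^-1 + n%:R * (h^-1 * h) by ring.
rewrite hV mulr1 -natr1.
have : 0 <= n%:R * h by rewrite mulr_ge0 // ltW.
lra.
Qed.

Definition disk_fps rho : {pred fps int} :=
  fun f => `[< converges_on_disk rho f >].

Fact disk_fps_subring rho : subring_closed (disk_fps rho).
Proof.
have memP f : reflect (forall t, 0 < t < rho -> coef_bounded f t)
    (f \in disk_fps rho).
  apply: (iffP (asboolP _)) => [cf t|]; last exact: bounded_converges.
  exact: converges_bounded cf.
split.
- by apply/memP => t _; exact: coef_bounded1.
- move=> f g /memP bf /memP bg; apply/memP => t tr.
  case/andP: (tr) => t0 _.
  by apply: coef_boundedD (bf _ tr) (coef_boundedN (bg _ tr)).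
- move=> f g /memP bf /memP bg; apply/memP => s /andP[s0 sr].
  pose t := (s + rho) / 2.
  have [st tr] : s < t /\ t < rho by rewrite !midf_lt.
  have t0r : 0 < t < rho by rewrite tr (lt_trans s0 st).
  by apply: coef_boundedM (bf _ t0r) (bg _ t0r); rewrite s0.
Qed.

HB.instance Definition _ rho :=
  GRing.isSubringClosed.Build (fps int) (disk_fps rho)
    (disk_fps_subring rho).

(* The ring of integer power series that converge on the open disk of
   radius rho, as a subring of fps int (Cauchy product). *)
Record Rdisk rho := Rdisk_Sub {
  Rdisk_val :> fps int;
  Rdisk_valP : Rdisk_val \in disk_fps rho
}.

HB.instance Definition _ rho := [isSub for @Rdisk_val rho].
HB.instance Definition _ rho := [Choice of Rdisk rho by <:].
HB.instance Definition _ rho := [SubChoice_isSubComNzRing of Rdisk rho by <:].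

End ConvergesOnDisk.

(* Main.v *)
From HB Require Import structures.
Require Import Defs.
From mathcomp Require Import all_boot all_order all_algebra.
From mathcomp Require Import all_reals.
From mathcomp Require Import boolp classical_sets topology normedtype sequences.
From mathcomp Require Import lra zify.

Set Implicit Arguments.
Unset Strict Implicit.
Unset Printing Implicit Defensive.

Import Order.TTheory GRing.Theory Num.Theory.
Import numFieldNormedType.Exports.

Local Open Scope ring_scope.

(** Write z for the variable. An abstract isomorphism must be composition with
    a power series, and the coefficients of power series in the image can then
    be made to grow too fast for the larger disk.

    For rho <= 1 the element 1 - z ^+ 2 is a unit of Rdisk rho, so a ring
    morphism to the integers sends z to an integer a with 1 - a ^+ 2 = 1 or -1,
    hence a = 0; the only such morphism is the constant coefficient
    (Rdisk_to_int). Consequently a ring morphism phi from Rdisk rho1 to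
    Rdisk rho2 preserves constant coefficients, phi z = z * u for some u, and,
    with S_n the truncation of f below degree n, the coefficient of index n of
    phi f is that of phi S_n plus (u_0) ^+ n * f_n (coef_rmorphism). When z is
    in the image of phi, u_0 is nonzero.

    Suppose now rho1 < rho2. Choose the f_n one after the other in {0, a_n},
    with a_n the ceiling of rho1 ^- n: since S_n is already known, at least one
    choice makes the coefficient of index n of phi f at least a_n / 2 in
    absolute value (greedy_coef_large). The resulting f converges for
    |z| < rho1 because f_n <= 2 rho1 ^- n, whereas phi f is unbounded at every
    radius t strictly between rho1 and rho2, so it is not in Rdisk rho2. Hence
    rho2 <= rho1 (rmorphism_radius_le); the inverse isomorphism gives the
    other inequality. *)

(** * The ring of a disk and its morphism to the integers *)

Section DiskRing.
Variables (R : realType) (rho : R).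
Implicit Types f g : Rdisk rho.

Lemma disk_fpsP (f : fps int) :
  reflect (forall t : R, 0 < t < rho -> coef_bounded f t) (f \in disk_fps rho).
Proof.
apply: (iffP (asboolP _)) => [cf t|]; last exact: bounded_converges.
exact: converges_bounded cf.
Qed.

Lemma Rdisk_bounded f (t : R) : 0 < t < rho -> coef_bounded f t.
Proof. exact/disk_fpsP/Rdisk_valP. Qed.

Lemma Rdisk_eqP f g : fps_coef f =1 fps_coef g -> f = g.
Proof. by move=> fg; apply/val_inj/fpsP. Qed.

Lemma coef_bounded_le1 (f : fps int) (t : R) :
  (forall n, `|fps_coef f n| <= 1) -> 0 < t <= 1 -> coef_bounded f t.
Proof.
move=> f1 /andP[t0 t1]; exists 1 => n.
rewrite -[leRHS]mulr1 ler_pM ?exprn_ge0 ?exprn_ile1 ?(ltW t0) //.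
by rewrite -intr_norm -[leRHS]/(1%:~R) ler_int.
Qed.

Lemma diskX_subproof : FPS (fun n => (n == 1%N)%:R) \in disk_fps rho.
Proof.
apply/disk_fpsP => t /andP[t0 _]; exists t => n /=.
by case: eqP => [->|_]; rewrite ?normr1 ?normr0 ?mul1r ?mul0r // ltW.
Qed.

Definition diskX : Rdisk rho := Rdisk_Sub diskX_subproof.

Lemma coef_diskXM f n :
  fps_coef (diskX * f) n = if n is m.+1 then fps_coef f m else 0.
Proof.
rewrite fps_coefM; case: n => [|n].
  by rewrite big_ord1 /= mul0r.
rewrite big_ord_recl /= mul0r add0r big_ord_recl /= mul1r.
by rewrite subSS subn0 big1 ?addr0 // => i _; rewrite mul0r.
Qed.

Lemma coef_diskXnM f n : fps_coef (diskX ^+ n * f) n = fps_coef f 0.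
Proof. by elim: n => [|n IH]; rewrite ?mul1r // exprS -mulrA coef_diskXM. Qed.

Definition disk_coef0 f : int := fps_coef f 0.

Fact disk_coef0_zmod : zmod_morphism disk_coef0.
Proof. by []. Qed.

Fact disk_coef0_monoid : monoid_morphism disk_coef0.
Proof. by split=> // f g; rewrite /disk_coef0 fps_coefM big_ord1. Qed.

HB.instance Definition _ :=
  GRing.isZmodMorphism.Build _ _ disk_coef0 disk_coef0_zmod.
HB.instance Definition _ :=
  GRing.isMonoidMorphism.Build _ _ disk_coef0 disk_coef0_monoid.

Lemma disk_shift_subproof f :
  FPS (fun n => fps_coef f n.+1) \in disk_fps rho.
Proof.
apply/disk_fpsP => t tr; have [M HM] := Rdisk_bounded f tr.
case/andP: tr => t0 _; exists (M / t) => n /=.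
by rewrite ler_pdivlMr // -mulrA -exprSr.
Qed.

Definition disk_shift f : Rdisk rho := Rdisk_Sub (disk_shift_subproof f).

Lemma coef_int (c : int) n :
  fps_coef (c%:~R : Rdisk rho) n = if n is 0 then c else 0.
Proof.
have natc m : fps_coef (m%:R : Rdisk rho) n = if n is 0 then m%:R else 0.
  elim: m => [|m IH]; first by case: n.
  by rewrite -!natr1 fps_coefD IH fps_coef1; case: n {IH} => [|n].
case: c => m; rewrite ?NegzE ?mulrNz ?fps_coefN -pmulrn natc.
  by case: n {natc} => // ; rewrite natz.
by case: n {natc} => //; rewrite natz.
Qed.

Lemma disk_shiftE f : f = (disk_coef0 f)%:~R + diskX * disk_shift f.
Proof.
apply: Rdisk_eqP => n; rewrite fps_coefD coef_int coef_diskXM.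
by case: n => [|n]; rewrite ?addr0 ?add0r.
Qed.

Lemma coef0_iter_shift n f :
  disk_coef0 (iter n disk_shift f) = fps_coef f n.
Proof. by elim: n f => // n IH f; rewrite iterSr IH. Qed.

(** The inverse is the series of the even powers of the variable, whose
    coefficients are bounded, so it converges on the unit disk. *)
Lemma diskX_unit : rho <= 1 -> exists e, (1 - diskX ^+ 2) * e = 1.
Proof.
move=> r1.
have eP : FPS (fun n => (~~ odd n)%:R) \in disk_fps rho.
  apply/disk_fpsP => t /andP[t0 tr]; apply: coef_bounded_le1 => [n /=|].
    by case: odd.
  by rewrite t0 (le_trans (ltW tr)).
exists (Rdisk_Sub eP); apply: Rdisk_eqP => n.
rewrite mulrBl mul1r expr2 -mulrA fps_coefD fps_coefN coef_diskXM.
case: n => [|[|n]]; rewrite ?coef_diskXM /= ?subr0 //.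
by rewrite negbK subrr.
Qed.

(** The unit 1 - z ^+ 2 determines where the variable z goes: its image a makes
    1 - a ^+ 2 equal to 1 or -1, and 2 is not a square, so a = 0. *)
Lemma Rdisk_to_int (psi : {rmorphism Rdisk rho -> int}) :
  rho <= 1 -> psi =1 disk_coef0.
Proof.
move=> r1 f; rewrite {1}[f]disk_shiftE rmorphD rmorphM rmorph_int intz.
suff -> : psi diskX = 0 by rewrite mul0r addr0.
have [e /(congr1 psi)] := diskX_unit r1.
rewrite rmorphM rmorphB rmorph1 rmorphXn mulrC => /intUnitRing.unitzPl.
rewrite qualifE /=; move: (psi _) => a.
have : 1 < a \/ a < -1 \/ a = 0 \/ a = 1 \/ a = -1 by lia.
by case=> [|[|[->|[->|->]]]] // ? /orP[] /eqP; rewrite expr2; nia.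
Qed.

Definition disk_trunc (c : nat -> int) n : Rdisk rho :=
  \sum_(k < n) (c k)%:~R * diskX ^+ k.

(** This finite identity replaces an infinite sum: a ring morphism, which need
    not commute with limits, can be applied to it. *)
Lemma disk_truncE n f :
  f = disk_trunc (fps_coef f) n + diskX ^+ n * iter n disk_shift f.
Proof.
elim: n => [|n IH]; first by rewrite /disk_trunc big_ord0 add0r mul1r.
rewrite {1}IH {1}[iter n _ f]disk_shiftE coef0_iter_shift.
rewrite /disk_trunc big_ord_recr /= exprSr mulrDr addrA mulrA.
by rewrite [_ * _%:~R]mulrC.
Qed.

End DiskRing.

(** * Greedy choice of coefficients *)

(** Digit-by-digit choice of the coefficients c_n in {0, a_n} of a power series
    in X. The function L n sees only the partial sum of index n, that is, the
    digits already chosen. *)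
Section Greedy.
Variables (a : nat -> int) (A : nzRingType) (X : A) (L : nat -> A -> int).

Definition greedy_digit n s : int := if `|a n| <= 2 * `|L n s| then 0 else a n.

Fixpoint greedy_sum n : A :=
  if n is m.+1
  then greedy_sum m + (greedy_digit m (greedy_sum m))%:~R * X ^+ m else 0.

Definition greedy_coef n := greedy_digit n (greedy_sum n).

Lemma greedy_sumE n : greedy_sum n = \sum_(k < n) (greedy_coef k)%:~R * X ^+ k.
Proof. by elim: n => [|n IH]; rewrite ?big_ord0 // big_ord_recr /= -IH. Qed.

Lemma greedy_coef_le n : `|greedy_coef n| <= `|a n|.
Proof. by rewrite /greedy_coef /greedy_digit; case: ifP; rewrite ?normr0. Qed.

(** For integers e != 0 and |L| < |a| / 2, |L + e a| >= |a| - |L| > |a| / 2, so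
    one of the digits c = 0 and c = a always gives |L + e c| >= |a| / 2. *)
Lemma greedy_coef_large n e :
  e != 0 -> `|a n| <= 2 * `|L n (greedy_sum n) + e * greedy_coef n|.
Proof.
rewrite /greedy_coef /greedy_digit => e0; case: ifPn => [|].
  by rewrite mulr0 addr0.
rewrite -ltNge => La; move: (L n _) La => l La.
have : `|a n| <= `|e * a n| by rewrite normrM ler_peMl // -gtz0_ge1 normr_gt0.
have := lerB_normD (e * a n) l; rewrite [l + _]addrC; lia.
Qed.

End Greedy.

(** * Ring morphisms between disk rings *)

Section RingMorphism.
Variables (R : realType) (rho1 rho2 : R).
Variable phi : {rmorphism Rdisk rho1 -> Rdisk rho2}.
Hypothesis rho1_le1 : rho1 <= 1.

Lemma rmorphism_coef0 f : disk_coef0 (phi f) = disk_coef0 f.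
Proof. exact: (Rdisk_to_int (disk_coef0 (rho:=rho2) \o phi) rho1_le1). Qed.

(** The image of the variable has no constant term; u is its quotient by the
    variable of the target, and disk_coef0 u its linear coefficient. *)
Let u := disk_shift (phi (diskX rho1)).

Lemma rmorphism_diskX : phi (diskX rho1) = diskX rho2 * u.
Proof. by rewrite {1}[phi _]disk_shiftE rmorphism_coef0 add0r. Qed.

(** A preimage g of the variable has no constant term, so it is a multiple
    z * h of the variable; comparing linear coefficients gives u_0 h_0 = 1. *)
Lemma rmorphism_slope_neq0 :
  (exists g, phi g = diskX rho2) -> disk_coef0 u != 0.
Proof.
case=> g; rewrite [g]disk_shiftE => phig.
have g0 : disk_coef0 g = 0.
  by rewrite [g]disk_shiftE -rmorphism_coef0 phig.
move: phig; rewrite g0 add0r rmorphM rmorphism_diskX -mulrA.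
move=> /(congr1 (fun h : Rdisk rho2 => fps_coef h 1)); rewrite coef_diskXM.
rewrite -[LHS]/(disk_coef0 _) rmorphM /= => h1; apply/eqP => u0.
by rewrite u0 mul0r in h1.
Qed.

(** The coefficient of index n depends only on the coefficients of f up to n,
    and on the last one affinely: this is what the greedy choice requires. *)
Lemma coef_rmorphism n f : fps_coef (phi f) n =
  fps_coef (phi (disk_trunc rho1 (fps_coef f) n)) n
    + disk_coef0 u ^+ n * fps_coef f n.
Proof.
rewrite {1}[f](disk_truncE n) rmorphD fps_coefD; congr (_ + _).
rewrite rmorphM rmorphXn rmorphism_diskX exprMn -mulrA coef_diskXnM.
by rewrite -/(disk_coef0 _) rmorphM rmorphXn /= rmorphism_coef0 coef0_iter_shift.
Qed.

(** Apply the greedy choice to digits of size rho1 ^- n: the series obtained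
    lies in the source ring, and its image outgrows the radius rho2 if
    rho1 < rho2. *)
Lemma rmorphism_radius_le :
  0 < rho1 -> (exists g, phi g = diskX rho2) -> rho2 <= rho1.
Proof.
move=> r0 /rmorphism_slope_neq0 u0; rewrite leNgt; apply/negP => r12.
(* Digits as large as convergence on the disk of radius rho1 allows. *)
pose a n : int := Num.ceil (rho1 ^- n).
pose c := greedy_coef a (diskX rho1) (fun n s => fps_coef (phi s) n).
have a_ge n : rho1 ^- n <= `|a n|%:~R :> R.
  by rewrite (le_trans (ceil_ge _)) // ler_int ler_norm.
have a_le n : `|a n|%:~R <= 2 * rho1 ^- n :> R.
  have V1 : 1 <= rho1 ^- n by rewrite invf_ge1 ?exprn_gt0 // exprn_ile1 // ltW.
  have a0 : 0 <= a n by rewrite ceil_ge0 (lt_le_trans _ V1) //; lra.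
  have := ceilB1_lt (rho1 ^- n); rewrite -/(a n) ger0_norm // intrB; lra.
have cP : FPS c \in disk_fps rho1.
  apply/disk_fpsP => t /andP[t0 tr]; exists 2 => n /=.
  rewrite -intr_norm.
  apply: (@le_trans _ _ (2 * rho1 ^- n * t ^+ n)).
    rewrite ler_wpM2r ?exprn_ge0 ?(ltW t0) //; apply: le_trans (a_le n).
    by rewrite ler_int greedy_coef_le.
  rewrite -mulrA ler_piMr // -exprVn -exprMn exprn_ile1 //.
    by rewrite mulr_ge0 ?invr_ge0 ?ltW.
  by rewrite ler_pdivrMl // mulr1 ltW.
pose f : Rdisk rho1 := Rdisk_Sub cP.
have f_large n : `|a n| <= 2 * `|fps_coef (phi f) n|.
  rewrite coef_rmorphism /= -[disk_trunc _ _ _]greedy_sumE.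
  by apply: greedy_coef_large; rewrite expf_neq0.
pose t := (rho1 + rho2) / 2.
have [rt tr] : rho1 < t /\ t < rho2 by rewrite !midf_lt.
have t0 : 0 < t by exact: lt_trans rt.
have [M HM] := @Rdisk_bounded _ _ (phi f) t (introT andP (conj t0 tr)).
pose q := rho1 / t.
have q01 : 0 < q < 1.
  by rewrite divr_gt0 // ltr_pdivrMr // mul1r.
have qM n : 1 <= 2 * M * q ^+ n.
  have : rho1 ^- n * t ^+ n <= 2 * M.
    apply: le_trans (ler_wpM2l (ler0n _ 2) (HM n)).
    rewrite mulrA ler_pM2r ?exprn_gt0 // (le_trans (a_ge n)) //.
    rewrite -intr_norm -[2]/(2%:~R) -intrM ler_int; exact: f_large.
  rewrite mulrC ler_pdivrMr ?exprn_gt0 // => tM.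
  by rewrite expr_div_n mulrA ler_pdivlMr ?exprn_gt0 // mul1r.
have : ((fun n => 2 * M * q ^+ n) @ \oo --> 2 * M * 0)%classic.
  apply: cvgMr; apply: cvg_expr.
  by case/andP: q01 => q0 q1; rewrite gtr0_norm.
rewrite mulr0 => /cvgr_lt /(_ 1 ltr01)[N _ /(_ N)] /=.
by rewrite leqnn ltNge qM => /(_ isT).
Qed.

End RingMorphism.

Theorem theorem3p2 (R : realType) (rho1 rho2 : R)
    (hrho1 : 0 < rho1 <= 1) (hrho2 : 0 < rho2 <= 1) :
  (exists phi : {rmorphism Rdisk rho1 -> Rdisk rho2}, bijective phi)
    <-> rho1 = rho2.
Proof.
case/andP: hrho1 hrho2 => r1 r1' /andP[r2 r2']; split; last first.
  by move=> <-; exists idfun; exists id.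
case=> phi [psi phiK psiK]; apply/le_anti/andP; split.
  have psiz : zmod_morphism psi by exact: can2_zmod_morphism phiK psiK.
  have psim : monoid_morphism psi by exact: can2_monoid_morphism phiK psiK.
  pose psiR : {rmorphism Rdisk rho2 -> Rdisk rho1} := HB.pack psi
    (GRing.isZmodMorphism.Build _ _ psi psiz)
    (GRing.isMonoidMorphism.Build _ _ psi psim).
  apply: (@rmorphism_radius_le _ _ _ psiR) => //.
  by exists (phi (diskX rho1)); exact: phiK.
by apply: (@rmorphism_radius_le _ _ _ phi) => //; exists (psi (diskX rho2)).
Qed.
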